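(* Let $A$ be a finite set of integers such that $\min(A)=a$, with $3\leq a\leq 5$. Then there exist infinitely many pairwise non-isomorphic polyhedra $G$ satisfying $A_1(G)=A$.
   Context: All graphs are simple and finite. A polyhedron is a planar, $3$-connected graph. $A_1(G)$ is the set of distinct vertex degrees of $G$, i.e. $A_1(G)=\{\deg_G(u) : u\in V(G)\}$. *)

(* Defs.v *)
From HB Require Import structures.
From mathcomp Require Import all_boot all_order all_algebra finmap.
From mathcomp Require Import all_classical all_reals all_analysis.

Set Implicit Arguments.
Unset Strict Implicit.
Unset Printing Implicit Defensive.

Import Order.TTheory GRing.Theory Num.Theory.
Import numFieldNormedType.Exports.

Local Open Scope classical_set_scope.
Local Open Scope ring_scope.

Record sgraph := SGraph {
  vertex :> finType;
  adj : rel vertex;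
  adj_sym : symmetric adj;
  adj_irr : irreflexive adj
}.

Definition graph_iso (G H : sgraph) : Prop :=
  exists2 f : G -> H, bijective f & forall x y, adj (f x) (f y) = adj x y.

Definition degree (G : sgraph) (u : G) : nat := #|[set v | adj u v]%SET|.

Definition A1 (G : sgraph) : {fset int} := [fset (degree u)%:Z | u in G]%fset.

Definition avoid (G : sgraph) (S : {set G}) : rel G :=
  [rel x y | [&& x \notin S, y \notin S & adj x y]].

(* The bound on #|G| makes G minus S nonempty, so "connected" needs no separate
   nonemptiness clause. *)
Definition k_connected (k : nat) (G : sgraph) : Prop :=
  (k < #|G|)%N /\
  forall S : {set G}, (#|S| < k)%N ->
    forall x y : G, x \notin S -> y \notin S -> connect (avoid S) x y.

Definition edge_set (G : sgraph) : {set {set G}} :=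
  [set [set p.1; p.2] | p : G * G & adj p.1 p.2]%SET.

Definition is_arc (R : realType) (p q : R * R) (C : set (R * R)) : Prop :=
  exists f : R -> R * R,
    [/\ {within `[0, 1], continuous f},
        {in `[0, 1] &, injective f},
        f 0 = p, f 1 = q & C = f @` `[0, 1]].

(* Drawings are topological: edges are arbitrary simple arcs, not necessarily
   straight.  The last two clauses say that the interior of a drawn edge
   contains no vertex and that two distinct edges meet only in the images of
   their common ends. *)
Record plane_drawing (R : realType) (G : sgraph)
    (pt : G -> R * R) (arc : {set G} -> set (R * R)) : Prop := PlaneDrawing {
  drawing_inj : injective pt;
  drawing_arc : forall x y : G, adj x y ->
    is_arc (pt x) (pt y) (arc [set x; y]%SET);
  drawing_vertex : forall (E : {set G}) (z : G),
    E \in edge_set G -> arc E (pt z) -> z \in E;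
  drawing_edge : forall E F : {set G},
    E \in edge_set G -> F \in edge_set G -> E != F ->
    arc E `&` arc F `<=` [set pt z | z in [set` (E :&: F)%SET]]
}.

Definition planar (R : realType) (G : sgraph) : Prop :=
  exists (pt : G -> R * R) (arc : {set G} -> set (R * R)),
    plane_drawing pt arc.

Definition polyhedron (R : realType) (G : sgraph) : Prop :=
  planar R G /\ k_connected 3 G.

(* Main.v *)
Require Import Defs.
From HB Require Import structures.
From mathcomp Require Import all_boot all_order all_algebra finmap.
From mathcomp Require Import all_classical all_reals all_analysis.
From mathcomp Require Import zify ring lra.

Set Implicit Arguments.
Unset Strict Implicit.
Unset Printing Implicit Defensive.

Import Order.TTheory GRing.Theory Num.Theory.
Import numFieldNormedType.Exports.
Local Open Scope ring_scope.

(** The degrees in A are realised by one family of graphs.  Take a cycle of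
    length divisible by 4, the belt z_0, z_1, ..., and two further cycles of hubs,
    one on each side of it.  The belt vertices of even index are joined to the
    hubs on one side and those of odd index to the hubs on the other, each to
    exactly one hub, so that the neighbours of a hub on the belt form a block of
    consecutive vertices of the given parity.  A hub with a block of k - 2
    vertices has degree k, and k can be any number at least 3.  A belt vertex has
    degree 3; adding the chords from z_i to z_(i+2) for all i makes this degree 5,
    and adding only those with i = 0 or 1 modulo 4, which form a perfect matching,
    makes it 4.  Thus with a = min A, the belt vertices have degree a, and the
    hubs are given the degrees in A, padded with as many hubs of degree a as
    desired.  The padding yields infinitely many orders, hence pairwise
    non-isomorphic graphs.

    Planarity ([two_page_planar], [belt_graph_planar]): the vertices are put on
    a line and the edges drawn as parabolic arcs above or below it.  Such a
    drawing is plane as soon as no two edges of the same side interleave, which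
    leaves a check on a short list of types of edges ([adj_arc], [no_crossing]).

    3-connectedness ([belt_graph_3connected]) uses only the three cycles and the
    fans.  If both removed vertices lie on the belt, the hub cycles are intact
    and carry everything else ([belt_damaged]).  Otherwise the rest of the belt
    is connected, and each hub reaches it by one of three disjoint routes
    ([belt_intact], [hub_to_belt]). *)

(** * Two-page drawings *)

Section TwoPages.
Local Open Scope classical_set_scope.
Context (R : realType).

Definition page_sign (up : bool) : R := if up then 1 else - 1.

(** The parabolic arc on the segment from (X, 0) to (Y, 0), above the axis if
    [up] holds and below it otherwise.  Nonnegativity of the product says that
    the abscissa lies between X and Y, in whichever order these come. *)
Definition bow (up : bool) (X Y : R) : set (R * R) :=
  [set P | 0 <= (P.1 - X) * (Y - P.1) /\
           P.2 = page_sign up * ((P.1 - X) * (Y - P.1))].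

Lemma bow_sym up X Y : bow up X Y = bow up Y X.
Proof.
have e u : (u - X) * (Y - u) = (u - Y) * (X - u) by ring.
by apply/seteqP; split=> -[u v]; rewrite /bow /= e.
Qed.

Lemma bow_is_arc up (X Y : R) : X != Y -> is_arc (X, 0) (Y, 0) (bow up X Y).
Proof.
move=> XY.
have D0 : Y - X != 0 by rewrite subr_eq0 eq_sym.
exists (fun t => (X + t * (Y - X),
                  page_sign up * (t * (1 - t) * ((Y - X) * (Y - X))))).
split.
- apply: continuous_subspaceT => t.
  have c1 : X + x * (Y - X) @[x --> t] --> X + t * (Y - X).
    by apply: cvgD; [exact: cvg_cst | apply: cvgMr_tmp; exact: cvg_id].
  have c2 : page_sign up * (x * (1 - x) * ((Y - X) * (Y - X))) @[x --> t] -->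
            page_sign up * (t * (1 - t) * ((Y - X) * (Y - X))).
    apply: cvgMl_tmp; apply: cvgMr_tmp; apply: cvgM; first exact: cvg_id.
    by apply: cvgB; [exact: cvg_cst | exact: cvg_id].
  exact: (cvg_pair c1 c2).
- move=> t t' _ _ [] /addrI /(mulIf D0) -> //.
- by congr pair; ring.
- by congr pair; ring.
- apply/seteqP; split=> -[u v] /=.
  + move=> [/= h1 h2].
    exists ((u - X) / (Y - X)).
      have P : 0 < (Y - X) * (Y - X) by rewrite -expr2 exprn_even_gt0.
      rewrite /= in_itv /=; apply/andP; split.
        rewrite -(pmulr_lge0 _ P).
        have -> : (u - X) / (Y - X) * ((Y - X) * (Y - X)) =
                  (u - X) ^+ 2 + (u - X) * (Y - u) by field.
        by rewrite addr_ge0 ?sqr_ge0.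
      rewrite -subr_ge0 -(pmulr_lge0 _ P).
      have -> : (1 - (u - X) / (Y - X)) * ((Y - X) * (Y - X)) =
                (Y - u) ^+ 2 + (u - X) * (Y - u) by field.
      by rewrite addr_ge0 ?sqr_ge0.
    rewrite h2; congr pair; first by field.
    by congr (_ * _); field.
  + move=> [t]; rewrite in_itv /= => /andP[t0 t1] [<- <-]; split=> /=.
      have -> : (X + t * (Y - X) - X) * (Y - (X + t * (Y - X))) =
        t * (1 - t) * ((Y - X) ^+ 2) by ring.
      by rewrite mulr_ge0 ?sqr_ge0 // mulr_ge0 // subr_ge0.
    by congr (_ * _); ring.
Qed.

Lemma bow_axis up (X Y Z : R) : bow up X Y (Z, 0) -> Z = X \/ Z = Y.
Proof.
move=> [_ /= /esym/eqP]; rewrite !mulf_eq0 !subr_eq0 /page_sign.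
by case: up; rewrite ?oppr_eq0 oner_eq0 /= => /orP[] /eqP ->; [left|right|left|right].
Qed.

Lemma bow_between up (X Y u v : R) :
  X < Y -> bow up X Y (u, v) -> X <= u <= Y.
Proof. by move=> XY [/= h _]; apply/andP; split; nra. Qed.

Lemma bow_opposite (X Y X' Y' u v : R) :
  bow true X Y (u, v) -> bow false X' Y' (u, v) ->
  (u = X \/ u = Y) /\ (u = X' \/ u = Y') /\ v = 0.
Proof.
move=> h h'; have v0 : v = 0.
  by case: h h' => /= h1 -> [/= h2]; rewrite /page_sign; lra.
by move: h h'; rewrite v0 => /bow_axis ? /bow_axis ?.
Qed.

(** Two bows on the same side of the axis whose base intervals do not
    interleave meet at most in common ends: over nested intervals with an
    interior abscissa in common, both factors of the inner product are at most
    those of the outer one, and they agree only if the intervals do. *)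
Lemma bow_same up (X Y X' Y' u v : R) :
  X < Y -> X' < Y' -> X <= X' ->
  ~ (X < X' /\ X' < Y /\ Y < Y') ->
  bow up X Y (u, v) -> bow up X' Y' (u, v) ->
  (X = X' /\ Y = Y') \/
  (u = X \/ u = Y) /\ (u = X' \/ u = Y') /\ v = 0.
Proof.
move=> XY XY' le_X nc h h'.
have /andP[Xu uY] := bow_between XY h.
have /andP[Xu' uY'] := bow_between XY' h'.
have e : (u - X) * (Y - u) = (u - X') * (Y' - u).
  case: h h' => /= _ -> [/= _].
  by apply: mulfI; case: (up); rewrite ?oppr_eq0 oner_eq0.
have end_ok : (u - X) * (Y - u) = 0 ->
    (u = X \/ u = Y) /\ (u = X' \/ u = Y') /\ v = 0.
  move=> e0; have v0 : v = 0 by case: h => /= _ ->; rewrite e0 mulr0.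
  by move: h h'; rewrite v0 => /bow_axis ? /bow_axis ?.
have [e0|ne0] := eqVneq ((u - X) * (Y - u)) 0; first by right; exact: end_ok.
left; have ne0' : (u - X') * (Y' - u) != 0 by rewrite -e.
move: ne0 ne0'; rewrite !mulf_eq0 !subr_eq0 !negb_or.
move=> /andP[uX uY0] /andP[uX0 uY0'].
have {}Xu : X < u by rewrite lt_neqAle eq_sym uX.
have {}uY : u < Y by rewrite lt_neqAle eq_sym uY0.
have {}Xu' : X' < u by rewrite lt_neqAle eq_sym uX0.
have {}uY' : u < Y' by rewrite lt_neqAle eq_sym uY0'.
move: le_X; rewrite le_eqVlt => /orP[/eqP eX|ltX].
  split=> //; move: e; rewrite eX => /mulfI.
  by rewrite subr_eq0 (gt_eqF Xu') => /(_ isT); lra.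
have [le_Y|ltY] := leP Y' Y; last by case: nc; split=> //; split=> //; lra.
exfalso; nra.
Qed.

(** Planarity from a two-page book embedding: the vertices are placed on the
    axis at the abscissae [pos], and the edges are bows above or below it,
    chosen by [up] so that no two edges of one page interleave. *)
Lemma two_page_planar (G : sgraph) (pos : G -> nat) (up : rel G) :
  injective pos -> symmetric up ->
  (forall x y x' y' : G, adj x y -> adj x' y' -> up x y = up x' y' ->
     ~ (pos x < pos x' /\ pos x' < pos y /\ pos y < pos y')%N) ->
  planar R G.
Proof.
move=> pos_inj up_sym nocross.
pose X (x : G) : R := (pos x)%:R.
have X_inj : injective X.
  by move=> x y /eqP; rewrite /X eqr_nat => /eqP /pos_inj.
have ltX x y : (X x < X y) = (pos x < pos y)%N by rewrite /X ltr_nat.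
pose pt (x : G) : R * R := (X x, 0).
pose arc (E : {set G}) : set (R * R) :=
  [set P | exists x y, [/\ E = [set x; y]%SET, adj x y, X x < X y
                         & bow (up x y) (X x) (X y) P]].
have adjE x y : adj x y -> X x < X y \/ X y < X x.
  move=> xy; have /eqP : x <> y by move=> e; move: xy; rewrite e adj_irr.
  by rewrite -(inj_eq X_inj) neq_lt => /orP.
have arcE x y : adj x y -> arc [set x; y]%SET = bow (up x y) (X x) (X y).
  move=> xy; apply/seteqP; split=> P.
    move=> [x' [y' [e x'y' ltx'y' hP]]].
    have : x' \in [set x; y]%SET by rewrite e !inE eqxx.
    have : y' \in [set x; y]%SET by rewrite e !inE eqxx orbT.
    rewrite !inE => /orP[]/eqP ey /orP[]/eqP ex; subst x' y' => //.
    - by rewrite ltxx in ltx'y'.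
    - by rewrite bow_sym up_sym.
    - by rewrite ltxx in ltx'y'.
  move=> hP; case: (adjE _ _ xy) => lt.
    by exists x, y; split.
  exists y, x; split=> //; first by rewrite finset.setUC.
    by rewrite adj_sym.
  by rewrite bow_sym up_sym.
exists pt, arc; split.
- by move=> x y [] /X_inj.
- move=> x y xy; rewrite arcE //; apply: bow_is_arc.
  by case: (adjE _ _ xy) => lt; rewrite ?(lt_eqF lt) ?(gt_eqF lt).
- move=> E z _ [x [y [-> xy ltxy]]] /bow_axis [] /X_inj ->;
  by rewrite !inE eqxx ?orbT.
- move=> E F _ _ neEF [u v] [[x [y [eE xy ltxy hE]]] [x' [y' [eF x'y' ltx'y' hF]]]].
  have common : (u = X x \/ u = X y) -> (u = X x' \/ u = X y') -> v = 0 ->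
      [set pt z | z in [set` (E :&: F)%SET]] (u, v).
    move=> h h' ->.
    suff [z zE] : exists2 z, z \in (E :&: F)%SET & u = X z.
      by move=> ->; exists z.
    rewrite eE eF; case: h => e; case: h' => e'; move: (e');
      rewrite e => /X_inj ez; [exists x | exists x | exists y | exists y] => //;
      by rewrite !inE eqxx -?ez ?eqxx ?orbT.
  have [eup|neup] := eqVneq (up x y) (up x' y'); last first.
    move: hE hF neup; case: (up x y); case: (up x' y') => // hE hF _.
      by have [? [? ?]] := bow_opposite hE hF; exact: common.
    by have [? [? ?]] := bow_opposite hF hE; exact: common.
  rewrite -eup in hF.
  have nested x1 y1 x2 y2 : adj x1 y1 -> adj x2 y2 -> up x1 y1 = up x2 y2 ->
      ~ (X x1 < X x2 /\ X x2 < X y1 /\ X y1 < X y2).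
    by rewrite !ltX; exact: nocross.
  have [le|/ltW le] := leP (X x) (X x').
    have nc := nested _ _ _ _ xy x'y' eup.
    case: (bow_same ltxy ltx'y' le nc hE hF); last by move=> [? [? ?]]; exact: common.
    by move=> [/X_inj ex /X_inj ey]; case/eqP: neEF; rewrite eE eF ex ey.
  have nc := nested _ _ _ _ x'y' xy (esym eup).
  case: (bow_same ltx'y' ltxy le nc hF hE); last by move=> [? [? ?]]; exact: common.
  by move=> [/X_inj ex /X_inj ey]; case/eqP: neEF; rewrite eE eF ex ey.
Qed.

End TwoPages.

(** * Connectivity and counting *)

Local Open Scope nat_scope.

Lemma connect_walk (T : finType) (e : rel T) (c : nat -> T) i j :
  i <= j -> (forall k, i <= k < j -> e (c k) (c k.+1)) ->
  connect e (c i) (c j).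
Proof.
move=> le_ij; rewrite -(subnKC le_ij); elim: (j - i) => [|d IHd] ce.
  by rewrite addn0 connect0.
rewrite addnS; apply: (connect_trans (IHd _)) => [k hk|]; first by apply: ce; lia.
by apply/connect1/ce; lia.
Qed.

(** A cycle from which the single vertex [c i0] is removed stays connected;
    with [n <= i0] nothing is removed. *)
Lemma connect_ring (T : finType) (e : rel T) (c : nat -> T) n i0 :
  symmetric e ->
  (forall k, k.+1 < n -> k != i0 -> k.+1 != i0 -> e (c k) (c k.+1)) ->
  (0 != i0 -> n.-1 != i0 -> e (c n.-1) (c 0)) ->
  forall i j, i < n -> j < n -> i != i0 -> j != i0 -> connect e (c i) (c j).
Proof.
move=> e_sym ce ce0.
have main i j : i <= j -> i < n -> j < n -> i != i0 -> j != i0 ->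
    connect e (c i) (c j).
  move=> le_ij ltin ltjn ii0 ji0.
  have [/andP[i0i i0j]|out] := boolP (i < i0 < j); last first.
    by apply: connect_walk => // k hk; apply: ce; lia.
  apply: (@connect_trans _ _ (c 0)).
    rewrite sym_connect_sym //; apply: connect_walk => // k hk; apply: ce; lia.
  apply: (@connect_trans _ _ (c n.-1)).
    by rewrite sym_connect_sym //; apply/connect1/ce0; lia.
  by rewrite sym_connect_sym //; apply: connect_walk => [|k hk]; first lia;
    apply: ce; lia.
move=> i j ltin ltjn ii0 ji0; have [/main->//|/ltnW le_ji] := leqP i j.
by rewrite sym_connect_sym // main.
Qed.

(** Pigeonhole: of three classes of vertices, a set of at most two vertices
    misses one. *)
Lemma small_set_misses (T : finType) (S : {set T}) (f : T -> nat) :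
  #|S| < 3 -> exists2 c, c < 3 & forall x, x \in S -> f x != c.
Proof.
move=> S3; have [/allP sub|/allPn[c]] :=
  boolP (all (fun c => c \in [seq f x | x <- enum S]) (iota 0 3)).
  have := uniq_leq_size (iota_uniq 0 3) sub.
  by rewrite size_iota size_map -cardE leqNgt S3.
rewrite mem_iota /= => c3 cS; exists c => // x xS.
by apply: contra cS => /eqP <-; apply: map_f; rewrite mem_enum.
Qed.

Lemma card_ord_seq n (P : pred nat) (t : seq nat) :
  uniq t -> (forall j, (j < n) && P j = (j \in t)) ->
  #|[set j : 'I_n | P j]| = size t.
Proof.
move=> t_uniq tE; rewrite cardE -(size_map val); apply: perm_size.
apply: uniq_perm => //; first by rewrite map_inj_uniq ?enum_uniq //; exact: val_inj.
move=> j; rewrite -tE; apply/mapP/andP => [[i]|[jn Pj]].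
  by rewrite mem_enum inE => Pi ->; split=> //; exact: ltn_ord.
by exists (Ordinal jn); rewrite ?mem_enum ?inE.
Qed.

(** * The belt graph *)

Section BeltGraph.

(** [a] is the common degree of the belt vertices, [p.+1] the length of the
    belt and [q.+1] the length of each of the two hub cycles.  The half-indices
    k < s q.+1 of the belt are cut into the blocks [s i, s i.+1), one for each
    i <= q. *)
Variables (a p q : nat) (s : nat -> nat).
Hypothesis a_bounds : 3 <= a <= 5.
Hypothesis q_ge2 : 2 <= q.
Hypothesis s0 : s 0 = 0.
Hypothesis s_lt : forall i, s i < s i.+1.
Hypothesis s_total : (s q.+1).*2 = p.+1.
Hypothesis p_mod4 : p.+1 %% 4 = 0.

Lemma s_mono i j : i <= j -> s i <= s j.
Proof.
move=> /subnKC <-; elim: (j - i) => [|d IHd]; first by rewrite addn0.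
by rewrite addnS (leq_trans IHd) // ltnW.
Qed.

Lemma s_ge i : i <= s i.
Proof. by elim: i => // i IHi; exact: leq_ltn_trans IHi (s_lt i). Qed.

Lemma p_ge7 : 7 <= p.
Proof. by move: (s_ge q.+1) q_ge2 s_total p_mod4; clear; lia. Qed.

Lemma p_odd : odd p.
Proof. by move: p_mod4; clear; lia. Qed.

Lemma block_exists k : k < s q.+1 -> exists2 i, i <= q & s i <= k < s i.+1.
Proof.
elim: q => [|i IHi] hk; first by exists 0; rewrite // s0.
have [lek|/IHi[i' le_i' hi']] := leqP (s i.+1) k; last by exists i' => //; lia.
by exists i.+1; rewrite ?lek.
Qed.

(** [j] follows [i] in the cyclic order of 0, ..., n - 1. *)
Definition next1 n i j := (j == i.+1) || (i.+1 == n) && (j == 0).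

(** [j] is two steps after [i] in the cyclic order of 0, ..., n - 1. *)
Definition next2 n i j :=
  [|| j == i.+2, (i.+2 == n) && (j == 0) | (i.+1 == n) && (j == 1)].

(** Whether the belt vertex [i] is joined to the one two steps further: never
    for a = 3 and always for a = 5.  For a = 4 the chords form a perfect
    matching, since the length of the belt is a multiple of 4. *)
Definition chord i := (a == 5) || (a == 4) && (i %% 4 < 2).

(** Adjacency of belt vertices. *)
Definition belt i j :=
  [|| next1 p.+1 i j, next1 p.+1 j i, next2 p.+1 i j && chord i
    | next2 p.+1 j i && chord j].

(** The belt vertex [j] is joined to the hub [(b, i)] when it has the parity of
    that hub cycle and its half-index lies in the block of [i]. *)
Definition fan (b : bool) i j := (odd j == b) && (s i <= j./2 < s i.+1).

(** The belt vertices, and the hubs of the two cycles indexed by [bool]. *)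
Definition belt_graph_vertex : finType := ('I_p.+1 + bool * 'I_q.+1)%type.

Definition belt_adj : rel belt_graph_vertex := fun u v =>
  match u, v with
  | inl i, inl j => belt i j
  | inl j, inr (b, i) => fan b i j
  | inr (b, i), inl j => fan b i j
  | inr (b, i), inr (b', i') =>
      (b == b') && (next1 q.+1 i i' || next1 q.+1 i' i)
  end.

Lemma belt_adj_sym : symmetric belt_adj.
Proof.
move=> [i|[b i]] [j|[b' j]] //=; first by
  rewrite /belt; do 2!case: (next1 _ _ _); do 2!case: (next2 _ _ _ && _).
by rewrite eq_sym orbC.
Qed.

Lemma belt_adj_irr : irreflexive belt_adj.
Proof.
move: p_ge7 q_ge2 => p7 q2 [i|[b i]] /=.
  by rewrite /belt /next1 /next2; move: p7; clear; lia.
by rewrite eqxx /next1; move: q2; clear; lia.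
Qed.

Definition belt_graph : sgraph := SGraph belt_adj_sym belt_adj_irr.

(** Belt vertices and hubs addressed by natural numbers, meaningful for
    [j <= p] and [i <= q]. *)
Definition zv (j : nat) : belt_graph := inl (inord j).
Definition hv (b : bool) (i : nat) : belt_graph := inr (b, inord i).

Lemma zvP (j : 'I_p.+1) : inl j = zv j.
Proof. by rewrite /zv inord_val. Qed.

Lemma zv_inj i j : i <= p -> j <= p -> zv i = zv j -> i = j.
Proof.
move=> ip jp e; have : inord i = inord j :> 'I_p.+1 by case: e.
by move/(congr1 val); rewrite /= !inordK.
Qed.

Lemma hvP b (i : 'I_q.+1) : inr (b, i) = hv b i.
Proof. by rewrite /hv inord_val. Qed.

(** * 3-connectedness *)

Section Connectivity.

Variable S : {set belt_graph}.
Hypothesis S_small : #|S| < 3.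

Let linked := connect (avoid S).

Lemma avoid_sym : symmetric (avoid S).
Proof. by move=> x y; rewrite /avoid /= belt_adj_sym andbCA. Qed.

Lemma linked_sym x y : linked x y = linked y x.
Proof. exact/sym_connect_sym/avoid_sym. Qed.

Lemma linked_refl x : linked x x.
Proof. exact: connect0. Qed.

Lemma linked_trans y x z : linked x y -> linked y z -> linked x z.
Proof. exact: connect_trans. Qed.

Lemma linked_adj x y : x \notin S -> y \notin S -> adj x y -> linked x y.
Proof. by move=> xS yS xy; apply: connect1; apply/and3P; split. Qed.

Lemma adj_zz j : j < p -> @adj belt_graph (zv j) (zv j.+1).
Proof. by move=> jp; rewrite /= !inordK /belt /next1 ?eqxx //; lia. Qed.

Lemma adj_zz0 : @adj belt_graph (zv p) (zv 0).
Proof. by rewrite /= !inordK /belt /next1 ?eqxx ?orbT. Qed.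

Lemma adj_hh b i : i < q -> @adj belt_graph (hv b i) (hv b i.+1).
Proof. by move=> iq; rewrite /= !inordK /next1 ?eqxx //; lia. Qed.

Lemma adj_hh0 b : @adj belt_graph (hv b q) (hv b 0).
Proof. by rewrite /= !inordK /next1 ?eqxx ?orbT. Qed.

Lemma adj_hz b i j : i <= q -> j <= p -> fan b i j -> @adj belt_graph (hv b i) (zv j).
Proof. by move=> iq jp; rewrite /= !inordK. Qed.

Lemma spoke_le (b : bool) i : i <= q -> (s i).*2 + b <= p.
Proof.
move=> iq; have := @s_mono i.+1 q.+1 iq; have := s_lt i.
by case: b; lia.
Qed.

Lemma adj_spoke (b : bool) i : i <= q -> @adj belt_graph (hv b i) (zv ((s i).*2 + b)).
Proof.
move=> iq; apply: adj_hz => //; first exact: spoke_le.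
by have := s_lt i; rewrite /fan; case: b; lia.
Qed.

(** If the removed vertices are two belt vertices, then both hub cycles are
    intact, every remaining belt vertex is joined to a hub, and one of the three
    edges from z_2c to z_2c+1, c < 3, remains and links the two hub cycles. *)
Lemma belt_damaged x y i j : i < j <= p -> zv i \in S -> zv j \in S ->
  x \notin S -> y \notin S -> linked x y.
Proof.
move=> /andP[ij jp] iS jS.
have hS b k : hv b k \notin S.
  apply/negP => kS.
  have : #|[set zv i; zv j; hv b k]%SET| <= #|S|.
    by apply/subset_leq_card/fintype.subsetP => v; rewrite !inE => /orP[/orP[]|]/eqP->.
  have neij : zv i != zv j.
    by apply/eqP => /zv_inj; lia.
  rewrite finset.setUC cardsU1 cards2 neij !inE /=.
  by rewrite leqNgt S_small.
have hub0 b k : k <= q -> linked (hv b k) (hv b 0).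
  move=> kq; rewrite linked_sym; apply: (@connect_walk _ _ (hv b)) => // l hl.
  by apply/and3P; split; rewrite ?hS //; apply: adj_hh; lia.
have zhub k : k <= p -> zv k \notin S -> linked (zv k) (hv (odd k) 0).
  move=> kp kS; have [|l lq hl] := @block_exists k./2; first by lia.
  apply: linked_trans (hub0 (odd k) l lq); rewrite linked_sym; apply: linked_adj => //.
  by apply: adj_hz; rewrite // /fan eqxx.
have cross b : linked (hv b 0) (hv false 0).
  case: b; last exact: linked_refl.
  pose f (v : belt_graph) := if v is inl j then (j : 'I_p.+1)./2 else 0.
  have [c c3 hc] := small_set_misses f S_small.
  have p7 := p_ge7.
  have zS (b : bool) : zv (c.*2 + b) \notin S.
    by apply/negP => /hc; rewrite /= inordK; case: b; lia.
  have z0 := zS false; have z1 := zS true.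
  apply: (@linked_trans (zv (c.*2 + 1))).
    have -> : true = odd (c.*2 + 1) by lia.
    by rewrite linked_sym zhub //; lia.
  apply: (@linked_trans (zv (c.*2))).
    rewrite linked_sym addn1; apply: linked_adj; [by rewrite -[c.*2]addn0| | ].
      by rewrite -addn1.
    by apply: adj_zz; lia.
  have -> : false = odd c.*2 by lia.
  by apply: zhub; [lia|rewrite -[c.*2]addn0].
have all0 v : v \notin S -> linked v (hv false 0).
  case: v => [k|[b k]].
    rewrite zvP => kS; apply: linked_trans (cross (odd k)).
    by apply: zhub => //; have := ltn_ord k.
  by rewrite hvP => _; apply: linked_trans (cross b); apply: hub0; have := ltn_ord k.
by move=> xS yS; apply: linked_trans (all0 x xS) _; rewrite linked_sym all0.
Qed.

(** A hub is joined to the belt by three routes that share no vertex but the hub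
    itself: directly, through the next hub, and through the previous one.  Two
    removed vertices cannot block all three. *)
Lemma hub_to_belt b i : i <= q -> hv b i \notin S ->
  exists j, [/\ j <= p, zv j \notin S & linked (hv b i) (zv j)].
Proof.
move=> iq iS.
pose nx := if i == q then 0 else i.+1.
pose pv := if i == 0 then q else i.-1.
have nxq : nx <= q by rewrite /nx; case: eqP; lia.
have pvq : pv <= q by rewrite /pv; case: eqP; lia.
have dist : [/\ nx != i, pv != i & nx != pv].
  by rewrite /nx /pv; split; do ?case: eqP; lia.
have adj_nx : @adj belt_graph (hv b i) (hv b nx).
  rewrite /nx; case: eqP => [->|?]; first exact: adj_hh0.
  by apply: adj_hh; lia.
have adj_pv : @adj belt_graph (hv b i) (hv b pv).
  rewrite adj_sym /pv; case: eqP => [->|?]; first exact: adj_hh0.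
  by have -> : i = i.-1.+1 by [lia]; apply: adj_hh; lia.
pose inblock k (v : belt_graph) :=
  match v with inl j => s k <= (j : 'I_p.+1)./2 < s k.+1
  | inr (_, k') => k' == k :> nat end.
(* The class of a vertex is the route on which it lies. *)
pose f v := if inblock i v then 0 else if inblock nx v then 1 else 2.
have [c c3 hc] := small_set_misses f S_small.
have disj k k' v : k != k' -> inblock k v -> inblock k' v = false.
  case: v => [j|[b' j]] /=; last by lia.
  by case: (ltngtP k k') => // lt _; have := s_mono lt; lia.
pose k := if c == 0 then i else if c == 1 then nx else pv.
have kq : k <= q by rewrite /k; do ?case: eqP => _.
have fk v : inblock k v -> f v = c.
  case: dist => d1 d2 d3.
  rewrite /k /f; case: c c3 {hc k kq} => [|[|[|//]]] _ /= h; rewrite ?h //.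
    by rewrite (disj _ _ _ d1 h).
  by rewrite (disj _ _ _ d2 h) (disj pv nx) // eq_sym.
have zin : inblock k (zv ((s k).*2 + b)).
  have := s_lt k; have := @spoke_le b _ kq => ??; rewrite /= inordK //.
  by case: (b) => /=; lia.
have hin : inblock k (hv b k) by rewrite /= inordK.
have nS v : inblock k v -> v \notin S.
  by move=> /fk fv; apply/negP => /hc; rewrite fv eqxx.
exists ((s k).*2 + b); split; [exact: spoke_le | exact: nS | ].
apply: (@linked_trans (hv b k)); last by apply: linked_adj; rewrite ?nS // adj_spoke.
move: (nS _ hin); rewrite /k; case: (c == 0) => [_|]; first exact: linked_refl.
by case: (c == 1) => kS; apply: linked_adj.
Qed.

(** At most one belt vertex is removed; [i0 > p] encodes that none is. *)
Lemma belt_intact i0 : (forall j, j <= p -> (zv j \in S) = (j == i0)) ->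
  forall x y, x \notin S -> y \notin S -> linked x y.
Proof.
move=> i0P.
have zR i j : i <= p -> j <= p -> zv i \notin S -> zv j \notin S ->
    linked (zv i) (zv j).
  move=> ip jp; rewrite !i0P // => iS jS.
  apply: (@connect_ring _ _ zv p.+1 i0 avoid_sym) => // [k kp k0 k1|k0 k1].
    by apply/and3P; split; rewrite ?i0P //; [lia|apply: adj_zz; lia].
  by apply/and3P; split; rewrite ?i0P //; apply: adj_zz0.
have toZ v : v \notin S -> exists j, [/\ j <= p, zv j \notin S & linked v (zv j)].
  case: v => [j|[b i]].
    rewrite zvP => jS; exists j; split=> //; last exact: linked_refl.
    by have := ltn_ord j.
  by rewrite hvP => iS; apply: hub_to_belt => //; have := ltn_ord i.
move=> x y /toZ[i [ip iS xi]] /toZ[j [jp jS yj]].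
apply: linked_trans xi _; apply: linked_trans (zR _ _ ip jp iS jS) _.
by rewrite linked_sym.
Qed.

End Connectivity.

Lemma card_belt_graph : #|belt_graph| = p.+1 + (q.+1).*2.
Proof. by rewrite card_sum card_prod card_bool !card_ord mul2n. Qed.

Lemma belt_graph_3connected : k_connected 3 belt_graph.
Proof.
split.
  rewrite card_belt_graph; have := p_ge7; lia.
move=> S S3 x y xS yS.
have [[i [j [hij iS jS]]]|no_two] :=
  pselect (exists i j, [/\ i < j <= p, zv i \in S & zv j \in S]).
  exact: belt_damaged hij iS jS xS yS.
have [[i ip iS]|none] := pselect (exists2 i, i <= p & zv i \in S).
  apply: (@belt_intact _ S3 i) => // j jp.
  apply/idP/eqP => [jS|-> //].
  by case: (ltngtP i j) => // lt; case: no_two; [exists i, j|exists j, i]; split=> //; lia.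
apply: (@belt_intact _ S3 p.+1) => // j jp.
rewrite (ltn_eqF (_ : j < p.+1)) //; apply/negP => jS.
by case: none; exists j.
Qed.

(** * Degrees *)

Lemma degree_split (u : belt_graph) :
  degree u = #|[set j : 'I_p.+1 | belt_adj u (inl j)]%SET| +
             #|[set h : bool * 'I_q.+1 | belt_adj u (inr h)]%SET|.
Proof. by rewrite /degree -!sum1dep_card big_sumType. Qed.

Lemma degree_hub b i : i <= q -> degree (hv b i) = 2 + (s i.+1 - s i).
Proof.
move=> iq; rewrite degree_split addnC; congr (_ + _).
  have -> : [set h | belt_adj (hv b i) (inr h)]%SET = finset.setX [set b]%SET
      [set j : 'I_q.+1 | next1 q.+1 i j || next1 q.+1 j i]%SET.
    by apply/finset.setP => -[b' j]; rewrite !inE /= inordK // eq_sym.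
  rewrite cardsX cards1 mul1n.
  rewrite (@card_ord_seq _ (fun j => next1 q.+1 i j || next1 q.+1 j i)
    [:: if i == q then 0 else i.+1; if i == 0 then q else i.-1]) //.
    by rewrite /= inE; case: (i =P q); case: (i =P 0); lia.
  by move=> j; rewrite !inE /next1; case: (i =P q); case: (i =P 0); lia.
have -> : [set j | belt_adj (hv b i) (inl j)]%SET = [set j : 'I_p.+1 | fan b i j]%SET.
  by apply/finset.setP => j; rewrite !inE /= inordK.
rewrite (@card_ord_seq _ (fan b i)
  [seq k.*2 + b | k <- iota (s i) (s i.+1 - s i)]).
- by rewrite size_map size_iota.
- by rewrite map_inj_uniq ?iota_uniq // => k k'; lia.
- move=> j; apply/andP/mapP => [[jp /andP[/eqP jb hj]]|[k]].
    by exists j./2; [rewrite mem_iota; lia | rewrite -jb; lia].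
  rewrite mem_iota => hk ->; have := @s_mono i.+1 q.+1 iq.
  by rewrite /fan; case: b; lia.
Qed.

Lemma degree_belt j : j <= p -> degree (zv j) = a.
Proof.
have p7 := p_ge7; have po := p_odd.
move=> jp; rewrite degree_split addnC.
have [i iq hi] : exists2 i, i <= q & s i <= j./2 < s i.+1.
  by apply: block_exists; lia.
have -> : [set h | belt_adj (zv j) (inr h)]%SET = [set (odd j, inord i)]%SET.
  apply/finset.setP => -[b k]; rewrite !inE /= inordK // /fan -[odd j == b]eq_sym.
  rewrite xpair_eqE; congr (_ && _).
  rewrite -val_eqE /= inordK //; case: (ltngtP k i) => // [lt|lt|->] //.
    by have := s_mono lt; lia.
  by have := s_mono lt; lia.
rewrite cards1.
(* The belt vertices one and two steps before and after [j]. *)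
pose pr := if j == 0 then p else j.-1.
pose nx := if j == p then 0 else j.+1.
pose pr2 := if j == 0 then p.-1 else if j == 1 then p else j.-2.
pose nx2 := if j == p then 1 else if j == p.-1 then 0 else j.+2.
have -> : [set k | belt_adj (zv j) (inl k)]%SET = [set k : 'I_p.+1 | belt j k]%SET.
  by apply/finset.setP => k; rewrite !inE /= inordK.
rewrite (@card_ord_seq _ (belt j) ([:: pr; nx] ++
   (if chord j then [:: nx2] else [::]) ++
   (if chord pr2 then [:: pr2] else [::]))).
- rewrite !size_cat /= /chord /pr2; move: a_bounds.
  do ?case: ifP; rewrite /=; lia.
- rewrite /= ; do 2!case: (chord _);
  rewrite /= ?inE /pr /nx /pr2 /nx2; move: p7 jp; clear;
  case: (j =P 0); case: (j =P 1); case: (j =P p); case: (j =P p.-1); lia.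
- move=> k; rewrite !mem_cat !inE.
  have -> : (k \in (if chord j then [:: nx2] else [::])) = (k == nx2) && chord j.
    by case: (chord j); rewrite !inE ?andbT ?andbF.
  have -> : (k \in (if chord pr2 then [:: pr2] else [::])) = (k == pr2) && chord k.
    by case: eqP => [->|ne]; case: (chord pr2); rewrite ?inE ?eqxx //; apply/eqP.
  rewrite /belt /next1 /next2 /pr /nx /pr2 /nx2.
  case: (chord j); case: (chord k); move: p7 jp; clear;
  case: (j =P 0); case: (j =P 1); case: (j =P p); case: (j =P p.-1); lia.
Qed.

(** * Planarity of the belt graph *)

(** The order of the vertices along the axis, with u_i and w_i for the hubs
    [(false, i)] and [(true, i)], and z_j for the belt vertices:
      u_(q-1) ... u_0, z_0 ... z_(p-2), w_q ... w_0, z_p, z_(p-1), u_q.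
    The fans of the u_i nest above the axis and those of the w_i below it.  If
    z_(p-1) and z_p stood next to z_(p-2), the edge from z_0 to z_p would cross a
    fan on either side; with the column z_p, z_(p-1), u_q at the far right, all
    the edges that close the three cycles find room. *)
Definition belt_pos (v : belt_graph) : nat :=
  match v with
  | inl j => if j == p :> nat then q.*2 + p
             else if j == p.-1 :> nat then (q.*2 + p).+1 else q + j
  | inr (false, i) => if i == q :> nat then (q.*2 + p).+2 else q.-1 - i
  | inr (true, i) => (q.*2 + p).-1 - i
  end.

(** Selects, among the edges, those to be drawn below the axis, each in one of
    its two orientations. *)
Definition belt_lower (u v : belt_graph) : bool :=
  match u, v with
  | inl i, inl j =>
      [|| [&& odd i, j == i.+2 :> nat & j <= p - 2],
          (i == 0 :> nat) && (p.-1 <= j) | (i == 1 :> nat) && (j == p :> nat)]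
  | inl j, inr (true, _) => j <= p - 2
  | inr (false, i), inr (false, i') => (i == 0 :> nat) && (i' == q :> nat)
  | _, _ => false
  end.

Definition belt_upper : rel belt_graph :=
  fun u v => ~~ (belt_lower u v || belt_lower v u).

Lemma belt_pos_inj : injective belt_pos.
Proof.
have p7 := p_ge7.
have inj_z (j j' : 'I_p.+1) : j = j' :> nat -> inl j = inl j' :> belt_graph.
  by move=> e; congr inl; exact: val_inj.
have inj_h b (i i' : 'I_q.+1) : i = i' :> nat -> inr (b, i) = inr (b, i') :> belt_graph.
  by move=> e; congr (inr (_, _)); exact: val_inj.
move=> [j|[[] i]] [j'|[[] i']] /= e; try apply: inj_z; try apply: inj_h;
  try (have := ltn_ord j); try (have := ltn_ord j'); try (have := ltn_ord i);
  try (have := ltn_ord i'); move: e; do ?case: ifP; lia.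
Qed.

(** The possible edges of the drawing: the page ([true] above the axis), the
    left end and the right end.  An edge between neighbours on the axis fits on
    either page. *)
Variant arc_spec : bool -> nat -> nat -> Prop :=
| ArcNext b x : arc_spec b x x.+1
| ArcFalse i j of i < q & j <= p - 2 & ~~ odd j & s i <= j./2 < s i.+1 :
    arc_spec true (q.-1 - i) (q + j)
| ArcEven j of j.+2 <= p - 2 & ~~ odd j : arc_spec true (q + j) (q + j.+2)
| ArcLast j of j <= p - 2 & ~~ odd j & s q <= j./2 :
    arc_spec true (q + j) (q.*2 + p).+2
| ArcHubs : arc_spec true 0 (q.*2 + p).+2
| ArcEnd1 : arc_spec true (q + (p - 2)) (q.*2 + p)
| ArcEnd2 : arc_spec true (q + (p - 2)) (q.*2 + p).+1
| ArcEnd3 : arc_spec true (q + (p - 3)) (q.*2 + p).+1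
| ArcTrueHubs : arc_spec true (q + p).-1 (q.*2 + p).-1
| ArcTrueLast : arc_spec true (q + p).-1 (q.*2 + p)
| ArcTrue i j of i <= q & j <= p - 2 & odd j & s i <= j./2 < s i.+1 :
    arc_spec false (q + j) ((q.*2 + p).-1 - i)
| ArcOdd j of j.+2 <= p - 2 & odd j : arc_spec false (q + j) (q + j.+2)
| ArcClose1 : arc_spec false q (q.*2 + p)
| ArcClose2 : arc_spec false q (q.*2 + p).+1
| ArcClose3 : arc_spec false q.+1 (q.*2 + p)
| ArcCloseHubs : arc_spec false q.-1 (q.*2 + p).+2.

Lemma no_crossing b x y b' x' y' : arc_spec b x y -> arc_spec b' x' y' ->
  b = b' -> ~ (x < x' /\ x' < y /\ y < y').
Proof.
have p7 := p_ge7; have po := p_odd.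
have mono i i' : i < i' -> s i.+1 <= s i' by move=> ?; exact: s_mono.
case=> [b0 x0|i j hi hj oj hf|j hj oj|j hj oj hl||||||
  |i j hi hj oj hf|j hj oj||||];
case=> [b1 x1|i' j' hi' hj' oj' hf'|j' hj' oj'|j' hj' oj' hl'||||||
  |i' j' hi' hj' oj' hf'|j' hj' oj'||||];
move=> eb [lt1 [lt2 lt3]]; try discriminate eb; try lia;
try (have := mono i i'); try (have := mono i' i);
try (have := mono i q); try (have := mono i' q); lia.
Qed.

(** The edge [u v] is one of those listed in [arc_spec]. *)
Definition arc_ok (u v : belt_graph) : Prop :=
  arc_spec (belt_upper u v) (minn (belt_pos u) (belt_pos v))
    (maxn (belt_pos u) (belt_pos v)).

Lemma arc_ok_sym u v : arc_ok u v -> arc_ok v u.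
Proof. by rewrite /arc_ok /belt_upper orbC minnC maxnC. Qed.

Lemma arc_ok_eq u v b x y : arc_spec b x y -> belt_upper u v = b ->
  minn (belt_pos u) (belt_pos v) = x -> maxn (belt_pos u) (belt_pos v) = y ->
  arc_ok u v.
Proof. by rewrite /arc_ok => ? -> -> ->. Qed.

Ltac place c :=
  apply: (arc_ok_eq c); rewrite /belt_upper //=; do ?case: ifP; lia.

Lemma next1_belt_arc (i j : 'I_p.+1) : next1 p.+1 i j -> arc_ok (inl i) (inl j).
Proof.
have p7 := p_ge7; have po := p_odd.
have := ltn_ord i; have := ltn_ord j; move=> jp ip /orP[/eqP ji|/andP[/eqP e1 /eqP e2]].
  have [lej|gtj] := leqP j (p - 2).
    place (ArcNext (belt_upper (inl i) (inl j)) (q + i)).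
  have [ei|ni] := eqVneq (j : nat) p.
    place (ArcNext (belt_upper (inl i) (inl j)) (q.*2 + p)).
  place ArcEnd2.
place ArcClose1.
Qed.

Lemma next2_belt_arc (i j : 'I_p.+1) : next2 p.+1 i j -> arc_ok (inl i) (inl j).
Proof.
have p7 := p_ge7; have po := p_odd.
have := ltn_ord i; have := ltn_ord j.
move=> jp ip /or3P[/eqP ji|/andP[/eqP e1 /eqP e2]|/andP[/eqP e1 /eqP e2]].
- have [lej|gtj] := leqP j (p - 2).
    rewrite ji in lej.
    by case oi: (odd i); [place (ArcOdd lej oi) | place (ArcEven lej (negbT oi))].
  by have [ei|ni] := eqVneq (j : nat) p; [place ArcEnd1 | place ArcEnd3].
- place ArcClose2.
- place ArcClose3.
Qed.

Lemma fan_arc b (i : 'I_q.+1) (j : 'I_p.+1) : fan b i j ->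
  arc_ok (inr (b, i)) (inl j).
Proof.
have p7 := p_ge7; have po := p_odd.
have := ltn_ord i; have := ltn_ord j; have := s_lt q.
move=> sq jp ip /andP[/eqP oj hj].
have [lej|gtj] := leqP j (p - 2); last first.
  have iq : i = q :> nat.
    by case: (ltngtP i q) => // lt; [have := s_mono lt|]; lia.
  by case: b oj => oj; [place ArcTrueLast |
     place (ArcNext (belt_upper (inr (false, i)) (inl j)) (q.*2 + p).+1)].
case: b oj => oj.
  by place (ArcTrue ip lej oj hj).
have [iq|iq] := ltnP i q; first by place (ArcFalse iq lej (negbT oj) hj).
have {}iq : i = q :> nat by lia.
have sj : s q <= j./2 by rewrite -iq; lia.
by place (ArcLast lej (negbT oj) sj).
Qed.

Lemma hub_arc b (i j : 'I_q.+1) : next1 q.+1 i j ->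
  arc_ok (inr (b, i)) (inr (b, j)).
Proof.
have p7 := p_ge7; have po := p_odd.
have := ltn_ord i; have := ltn_ord j.
move=> jp ip /orP[/eqP ji|/andP[/eqP e1 /eqP e2]]; case: b.
- place (ArcNext (belt_upper (inr (true, i)) (inr (true, j))) ((q.*2 + p).-1 - j)).
- have [jq|jq] := eqVneq (j : nat) q; first by place ArcHubs.
  place (ArcNext (belt_upper (inr (false, i)) (inr (false, j))) (q.-1 - j)).
- place ArcTrueHubs.
- place ArcCloseHubs.
Qed.

Lemma adj_arc (u v : belt_graph) : adj u v -> arc_ok u v.
Proof.
case: u v => [i|[b i]] [j|[b' j]] /=.
- case/or4P=> [/next1_belt_arc//|/next1_belt_arc/arc_ok_sym//| |].
    by case/andP=> /next2_belt_arc.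
  by case/andP=> /next2_belt_arc/arc_ok_sym.
- by move/fan_arc/arc_ok_sym.
- exact: fan_arc.
- case/andP=> /eqP <- /orP[/hub_arc|/hub_arc/arc_ok_sym]; exact.
Qed.

Lemma belt_graph_planar (R : realType) : planar R belt_graph.
Proof.
apply: (@two_page_planar R belt_graph belt_pos belt_upper).
- exact: belt_pos_inj.
- by move=> u v; rewrite /belt_upper orbC.
move=> x y x' y' /adj_arc h /adj_arc h' e [lt1 [lt2 lt3]].
by apply: (no_crossing h h' e); lia.
Qed.

End BeltGraph.

(** * Realising a set of degrees *)

(** The starting points of the blocks: hubs 2k and 2k+1 of each cycle get degree
    [nth a L k], of which 2 is spent on the hub cycle.  Beyond the end of [L] the
    degree is [a].  Giving each degree to two consecutive hubs makes the belt
    length a multiple of 4. *)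
Definition blocks (a : nat) (L : seq nat) (i : nat) : nat :=
  \sum_(j < i) (nth a L j./2 - 2).

Lemma blocksS a L i : blocks a L i.+1 = blocks a L i + (nth a L i./2 - 2).
Proof. by rewrite /blocks big_ord_recr. Qed.

Lemma blocks_double_even a L r : ~~ odd (blocks a L r.*2).
Proof.
elim: r => [|r IHr]; first by rewrite /blocks big_ord0.
have half_r : r.*2.+1./2 = r by lia.
by rewrite doubleS !blocksS half_r doubleK; lia.
Qed.

(** The polyhedra, with [r.*2] hubs on each of the two hub cycles. *)
Lemma belt_polyhedron (R : realType) (a : nat) (L : seq nat) (r : nat) :
  3 <= a <= 5 -> {in L, forall d, 3 <= d} -> size L <= r -> 2 <= r ->
  exists G : sgraph,
    [/\ polyhedron R G,
        forall d, (exists u : G, degree u = d) <-> d = a \/ d \in L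
      & #|G| = (blocks a L r.*2 + r.*2).*2].
Proof.
move=> a_bounds L_ge3 sizeL r2.
pose s := blocks a L.
have nth_ge3 i : 3 <= nth a L i.
  by have [?|?] := ltnP i (size L); [rewrite L_ge3 ?mem_nth|rewrite nth_default; lia].
have s0 : s 0 = 0 by rewrite /s /blocks big_ord0.
have s_lt i : s i < s i.+1 by rewrite /s blocksS; have := nth_ge3 i./2; lia.
pose q := (r.*2).-1; pose p := (s q.+1).*2.-1.
have q_ge2 : 2 <= q by rewrite /q; lia.
have eq : q.+1 = r.*2 by rewrite /q; lia.
have s_total : (s q.+1).*2 = p.+1.
  by rewrite /p prednK // double_gt0; apply: leq_ltn_trans (s_lt q).
have p_mod4 : p.+1 %% 4 = 0.
  by rewrite -s_total eq /s; have := blocks_double_even a L r; lia.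
pose G := belt_graph a q_ge2 s_lt s_total p_mod4.
have deg_hub b i : i <= q -> degree (hv a q_ge2 s_lt s_total p_mod4 b i) = nth a L i./2.
  move=> iq; rewrite degree_hub // /s blocksS; have := nth_ge3 i./2; lia.
have deg_belt j : j <= p -> degree (zv a q_ge2 s_lt s_total p_mod4 j) = a.
  exact: degree_belt.
exists G; split.
- by split; [exact: belt_graph_planar | exact: belt_graph_3connected].
- move=> d; split.
    move=> [[j|[b i]]].
      rewrite (zvP a q_ge2 s_lt s_total p_mod4) deg_belt => [<-|]; first by left.
      by have := ltn_ord j.
    rewrite (hvP a q_ge2 s_lt s_total p_mod4) deg_hub => [<-|]; last by have := ltn_ord i.
    have [?|?] := ltnP i./2 (size L); first by right; exact: mem_nth.
    by left; rewrite nth_default.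
  move=> [->|dL].
    by exists (zv a q_ge2 s_lt s_total p_mod4 0); rewrite deg_belt.
  exists (hv a q_ge2 s_lt s_total p_mod4 false (index d L).*2).
  have dn : index d L < size L by rewrite index_mem.
  by rewrite deg_hub ?doubleK ?nth_index //; rewrite /q; lia.
- by rewrite card_belt_graph -s_total eq /s doubleD.
Qed.

Local Close Scope nat_scope.

Theorem corollaryC2 (R : realType) (A : {fset int}) (a : int)
    (aA : a \in A) (a_min : forall b : int, b \in A -> a <= b)
    (a_bounds : 3 <= a <= 5) :
  exists G : nat -> sgraph,
    (forall n : nat, polyhedron R (G n) /\ A1 (G n) = A) /\
    (forall m n : nat, m <> n -> ~ graph_iso (G m) (G n)).
Proof.
pose k := `|a|%N; pose L := [seq `|b|%N | b <- A].
have A_ge3 b : b \in A -> 3 <= b by move/a_min; case/andP: a_bounds; lia.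
have k_bounds : (3 <= k <= 5)%N by rewrite /k; lia.
have L_ge3 : {in L, forall d, (3 <= d)%N} by move=> d /mapP[b /A_ge3 ? ->]; lia.
have mem_A d : (d%:Z \in A) = (d \in L).
  apply/idP/mapP => [dA|[b bA ->]]; first by exists d%:Z.
  by rewrite gez0_abs //; have := A_ge3 b bA; lia.
pose r n := (size L + n + 2)%N.
have [G GP] := choice (fun n => @belt_polyhedron R k L (r n) k_bounds L_ge3
  ltac:(rewrite /r; lia) ltac:(rewrite /r; lia)).
exists G; split=> [n|m n neq_mn [f f_bij _]].
  have [G_poly G_deg _] := GP n; split=> //.
  apply/fsetP => b; apply/imfsetP/idP => [[u _ ->]|bA].
    rewrite mem_A; case: (proj1 (G_deg _) (ex_intro _ u erefl)) => [->|//].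
    by apply/mapP; exists a.
  have [u du] : exists u : G n, degree u = `|b|%N.
    by apply/G_deg; right; apply/mapP; exists b.
  by exists u; rewrite //= du gez0_abs //; have := A_ge3 b bA; lia.
have [_ _ cm] := GP m; have [_ _ cn] := GP n.
have := bij_eq_card f_bij; rewrite cm cn.
have mono i j : (i <= j -> blocks k L i <= blocks k L j)%N.
  by move=> /subnKC <-; elim: (j - i)%N => [|d IHd]; rewrite ?addn0 // addnS blocksS; lia.
have := mono (r m).*2%N (r n).*2%N; have := mono (r n).*2%N (r m).*2%N.
by rewrite /r; lia.
Qed.
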